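(* Let $M$ be an ultrahomogeneous first order structure (of arbitrary cardinality). Then $M$ has the externally definable Ramsey property if and only if $M$ has FPT.
   Context: For a finite tuple $\bar a$ in $M$ and $B\subseteq M$, $\binom{B}{\bar a}$ is the set of tuples in $B$ which are images of $\bar a$ under automorphisms of $M$ (by ultrahomogeneity, these are the copies of $\bar a$ under embeddings); for finite $B\subseteq M$, $\binom{M}{B}$ is the set of images of $B$ under $\mathrm{Aut}(M)$. A coloring $c\colon\binom{M}{\bar a}\to 2^n$ is externally definable if there are formulas without parameters $\varphi_i(\bar x,\bar y)$ and complete types $p_i(\bar y)\in S_{\bar y}(M)$ over $M$, $i<n$ ($\bar y$ a finite tuple of variables), such that for all $\bar a'\in\binom{M}{\bar a}$, $i<n$: $c(\bar a')(i)=1$ if $\varphi_i(\bar a',\bar y)\in p_i(\bar y)$ and $c(\bar a')(i)=0$ if $\neg\varphi_i(\bar a',\bar y)\in p_i(\bar y)$. $M$ has the externally definable Ramsey property if for every finite $\bar a\subseteq B\subseteq M$ and every externally definable coloring $c$ of $\binom{M}{\bar a}$ there is $B'\in\binom{M}{B}$ with $|c[\binom{B'}{\bar a}]|=1$. $M$ has FPT (fixed points on type spaces property) if for every $n\ge 1$ every $\mathrm{Aut}(M)$-subflow (nonempty closed $\mathrm{Aut}(M)$-invariant subset) of $S_n(M)$, the space of complete $n$-types over $M$ with the natural action of $\mathrm{Aut}(M)$, has a fixed point. *)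

(* Defs.v *)
From HB Require Import structures.
From mathcomp Require Import all_boot all_order.
From mathcomp Require Import boolp classical_sets functions cardinality.
From mathcomp Require Import topology.

Set Implicit Arguments.
Unset Strict Implicit.
Unset Printing Implicit Defensive.

Local Open Scope classical_set_scope.

(** * First-order languages and structures *)

Record language := Language {
  fsym : Type;
  farity : fsym -> nat;
  rsym : Type;
  rarity : rsym -> nat }.

(* Constants are function symbols of arity 0. *)
Record structure (L : language) := Structure {
  carrier :> Type;
  finterp : forall f : fsym L, ('I_(farity f) -> carrier) -> carrier;
  rinterp : forall r : rsym L, ('I_(rarity r) -> carrier) -> Prop }.

Arguments finterp {L} s f _.
Arguments rinterp {L} s r _.

(* Terms and formulas are indexed by the type V of their free variables; the
   body of a quantifier has the free variables [option V], where [None] is the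
   bound one. *)
Inductive term (L : language) (V : Type) : Type :=
| Var of V
| App (f : fsym L) of 'I_(farity f) -> term L V.

Inductive formula (L : language) (V : Type) : Type :=
| Eq of term L V & term L V
| Rel (r : rsym L) of 'I_(rarity r) -> term L V
| Not of formula L V
| And of formula L V & formula L V
| Exists of formula L (option V).

Fixpoint eval L (M : structure L) V (e : V -> M) (t : term L V) : M :=
  match t with
  | Var x => e x
  | App f ts => finterp M f (fun i => eval e (ts i))
  end.

Definition extend (T V : Type) (e : V -> T) (x : T) (o : option V) : T :=
  if o is Some v then e v else x.

Fixpoint sat L (M : structure L) V (e : V -> M) (phi : formula L V) : Prop :=
  match phi with
  | Eq t u => eval e t = eval e u
  | Rel r ts => rinterp M r (fun i => eval e (ts i))
  | Not psi => ~ sat e psi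
  | And psi chi => sat e psi /\ sat e chi
  | Exists psi => exists x : M, sat (extend e x) psi
  end.

Fixpoint trename L V W (h : V -> W) (t : term L V) : term L W :=
  match t with
  | Var x => Var L (h x)
  | App f ts => App (fun i => trename h (ts i))
  end.

Fixpoint rename L V W (h : V -> W) (phi : formula L V) : formula L W :=
  match phi with
  | Eq t u => Eq (trename h t) (trename h u)
  | Rel r ts => Rel (fun i => trename h (ts i))
  | Not psi => Not (rename h psi)
  | And psi chi => And (rename h psi) (rename h chi)
  | Exists psi => Exists (rename (omap h) psi)
  end.

(** * Automorphisms *)

Record automorphism L (M : structure L) := Automorphism {
  aut_fun :> M -> M;
  aut_inv : M -> M;
  aut_funK : cancel aut_fun aut_inv;
  aut_invK : cancel aut_inv aut_fun;
  aut_finterp : forall f v, aut_fun (finterp M f v) = finterp M f (aut_fun \o v);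
  aut_rinterp : forall r v, rinterp M r (aut_fun \o v) <-> rinterp M r v }.

(** * Ultrahomogeneity *)

Definition substructure L (M : structure L) (A : set M) : Prop :=
  forall f v, (forall i, A (v i)) -> A (finterp M f v).

Definition finitely_generated L (M : structure L) (A : set M) : Prop :=
  exists2 S : set M, finite_set S & A = smallest (@substructure L M) S.

(* Only the restriction of h to A matters. *)
Definition partial_isomorphism L (M : structure L) (A B : set M) (h : M -> M) :
    Prop :=
  [/\ set_bij A B h,
      forall f v, (forall i, A (v i)) ->
        h (finterp M f v) = finterp M f (h \o v) &
      forall r v, (forall i, A (v i)) ->
        (rinterp M r (h \o v) <-> rinterp M r v)].

Definition ultrahomogeneous L (M : structure L) : Prop :=
  forall (A B : set M) (h : M -> M),
    finitely_generated A -> finitely_generated B ->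
    partial_isomorphism A B h ->
    exists g : automorphism M, forall x, A x -> g x = h x.

(** * Type spaces *)

(* An L(M)-formula in the variables y_0, ..., y_(n-1): [inl i] is the variable
   y_i, and [inr m] is the parameter m, always interpreted as itself. *)
Definition param_formula L (M : structure L) (n : nat) : Type :=
  formula L ('I_n + M).

Definition param_val (T : Type) n (b : 'I_n -> T) (v : 'I_n + T) : T :=
  match v with inl i => b i | inr m => m end.

(* By compactness, finite satisfiability in M is consistency with the
   elementary diagram of M. *)
Record complete_type L (M : structure L) (n : nat) := CompleteType {
  ctype_set :> set (param_formula M n);
  ctype_finsat : forall A : set (param_formula M n),
    finite_set A -> A `<=` ctype_set ->
    exists b : 'I_n -> M, forall phi, A phi -> sat (param_val b) phi;
  ctype_complete : forall phi : param_formula M n,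
    ctype_set phi \/ ctype_set (Not phi) }.

Definition type_basic_open L (M : structure L) n (phi : param_formula M n) :
    set (complete_type M n) :=
  [set p | ctype_set p phi].

Section TypeTopology.
Variables (L : language) (M : structure L) (n : nat).

HB.instance Definition _ := gen_eqMixin (complete_type M n).
HB.instance Definition _ := gen_choiceMixin (complete_type M n).
HB.instance Definition _ := @isSubBaseTopological.Build (complete_type M n)
  (set (complete_type M n)) (range (@type_basic_open L M n)) id.

End TypeTopology.

Section Action.
Variables (L : language) (M : structure L).

Lemma eval_rename V W (h : V -> W) (e : W -> M) (t : term L V) :
  eval e (trename h t) = eval (e \o h) t.
Proof. by elim: t => //= f ts IH; congr finterp; apply/funext => i. Qed.

Lemma sat_rename V W (h : V -> W) (e : W -> M) (phi : formula L V) :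
  sat e (rename h phi) <-> sat (e \o h) phi.
Proof.
elim: phi W h e => {V} /= [V t u|V r ts|V psi IH|V psi IH1 chi IH2|V psi IH] W h e.
- by rewrite !eval_rename.
- suff -> : (fun i => eval e (trename h (ts i))) =
            (fun i => eval (e \o h) (ts i)) by [].
  by apply/funext => i; rewrite eval_rename.
- by rewrite IH.
- by rewrite IH1 IH2.
- have E x : extend e x \o omap h = extend (e \o h) x.
    by apply/funext => -[].
  by split=> -[x]; rewrite ?IH ?E => sx; exists x; rewrite ?IH ?E.
Qed.

Lemma eval_automorphism (g : automorphism M) V (e : V -> M) (t : term L V) :
  eval (g \o e) t = g (eval e t).
Proof.
by elim: t => //= f ts IH; rewrite aut_finterp; congr finterp; apply/funext.
Qed.

Lemma sat_automorphism (g : automorphism M) V (e : V -> M) (phi : formula L V) :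
  sat (g \o e) phi <-> sat e phi.
Proof.
elim: phi e => {V} /= [V t u|V r ts|V psi IH|V psi IH1 chi IH2|V psi IH] e.
- by rewrite !eval_automorphism; split=> [/(can_inj (aut_funK g))|->].
- suff -> : (fun i => eval (g \o e) (ts i)) = g \o (fun i => eval e (ts i)).
    exact: aut_rinterp.
  by apply/funext => i; rewrite /= eval_automorphism.
- by rewrite IH.
- by rewrite IH1 IH2.
- have E x : extend (g \o e) (g x) = g \o extend e x.
    by apply/funext => -[].
  split=> -[x sx]; last by exists (g x); rewrite E IH.
  by exists (aut_inv g x); rewrite -IH -E aut_invK.
Qed.

Definition rename_params n (h : M -> M) : param_formula M n -> param_formula M n :=
  rename (fun v => match v with inl i => inl i | inr m => inr (h m) end).

(* g p = {phi(y, g m) : phi(y, m) in p}, i.e. phi(y, m) is in g p if and only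
   if phi(y, g^-1 m) is in p. *)
Definition act_set n (g : automorphism M) (p : complete_type M n) :
    set (param_formula M n) :=
  [set phi | ctype_set p (rename_params (aut_inv g) phi)].

Lemma act_finsat n (g : automorphism M) (p : complete_type M n)
    (A : set (param_formula M n)) :
  finite_set A -> A `<=` act_set g p ->
  exists b : 'I_n -> M, forall phi, A phi -> sat (param_val b) phi.
Proof.
move=> finA Ap.
have [||b bP] := ctype_finsat (c := p) (A := rename_params (aut_inv g) @` A).
- exact: finite_image.
- by move=> _ [phi /Ap ? <-].
exists (g \o b) => phi Aphi.
have /sat_rename/(sat_automorphism g) : sat (param_val b)
  (rename_params (aut_inv g) phi) by apply: bP; exists phi.
by congr sat; apply/funext => -[i|m] //=; rewrite aut_invK.
Qed.

Lemma act_complete n (g : automorphism M) (p : complete_type M n)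
    (phi : param_formula M n) :
  act_set g p phi \/ act_set g p (Not phi).
Proof. exact: (ctype_complete p (rename_params (aut_inv g) phi)). Qed.

Definition act n (g : automorphism M) (p : complete_type M n) :
    complete_type M n :=
  CompleteType (@act_finsat n g p) (act_complete g p).

End Action.

(** * Fixed points on type spaces *)

Definition subflow L (M : structure L) n (X : set (complete_type M n)) : Prop :=
  [/\ X !=set0, closed X & forall (g : automorphism M) p, X p -> X (act g p)].

Definition FPT L (M : structure L) : Prop :=
  forall n, (1 <= n)%N -> forall X : set (complete_type M n), subflow X ->
  exists2 p, X p & forall g : automorphism M, act g p = p.

(** * The externally definable Ramsey property *)

Definition tuple_copies L (M : structure L) (B : set M) k (a : 'I_k -> M) :
    set ('I_k -> M) :=
  [set a' | range a' `<=` B /\ exists g : automorphism M, a' = g \o a].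

Definition set_copies L (M : structure L) (B : set M) : set (set M) :=
  [set B' | exists g : automorphism M, B' = g @` B].

(* phi(a, y) for a formula phi(x, y) without parameters; [inl] and [inr] are
   the variables x and y. *)
Definition instance L (M : structure L) k m (phi : formula L ('I_k + 'I_m))
    (a : 'I_k -> M) : param_formula M m :=
  rename (fun v => match v with inl i => inr (a i) | inr j => inl j end) phi.

(* A coloring of the copies of a is given by a function on all k-tuples, of
   which only the values at copies of a are used; [true] is the color 1. *)
Definition externally_definable L (M : structure L) k (a : 'I_k -> M) n
    (c : ('I_k -> M) -> {ffun 'I_n -> bool}) : Prop :=
  exists (m : nat) (phi : 'I_n -> formula L ('I_k + 'I_m))
         (p : 'I_n -> complete_type M m),
    forall a' (i : 'I_n), tuple_copies setT a a' ->
      (ctype_set (p i) (instance (phi i) a') -> c a' i = true) /\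
      (ctype_set (p i) (Not (instance (phi i) a')) -> c a' i = false).

Definition externally_definable_Ramsey L (M : structure L) : Prop :=
  forall k (a : 'I_k -> M) (B : set M), finite_set B -> range a `<=` B ->
  forall n (c : ('I_k -> M) -> {ffun 'I_n -> bool}),
    externally_definable a c ->
    exists2 B', set_copies B B' & (c @` tuple_copies B' a #= `I_1)%card.

(* Main.v *)
From mathcomp Require Import all_boot.
From mathcomp Require Import boolp classical_sets functions cardinality.
From mathcomp Require Import topology.
Require Import Defs.

(** Both implications rest on one computation.  For a type [q] and a formula
    psi(x, y), put c(a') = 1 if psi(a', y) is in [q], and c(a') = 0 otherwise.
    Since psi(a', y) belongs to [g q] if and only if psi(g^-1 a', y) belongs to
    [q] ([act_instance]), a translate g q cannot tell apart the
    copies of a inside a finite set B exactly when g^-1 B is monochromatic for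
    c.  A fixed point cannot tell apart any two copies of any tuple.  So a
    monochromatic copy of B is the same thing as a point of the orbit of q that
    satisfies finitely many of the conditions that define a fixed point.

    From fixed points to Ramsey.  The types p_i that define a coloring are
    first merged into a single type q in more variables ([joint_type]).  The
    closure of the orbit of q is a subflow, so it contains a fixed point r.
    Only finitely many instances are concerned with the copies of a in B, so
    some g q agrees with r on all of them, and g^-1 B is monochromatic.

    From Ramsey to fixed points.  Let p be a point of the subflow X.  To be
    fixed means that phi and g phi have the same truth value, for each
    formula phi over M and each automorphism g.  For finitely many such pairs
    (g_j, phi_j), all the parameters can be listed in one tuple a, so that
    phi_j is psi_j(a, y).  The formulas psi_j define by means of p a coloring
    of the copies of a; if h B is monochromatic, where B contains a and all
    the g_j a, then h^-1 p satisfies these finitely many conditions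
    ([Ramsey_finite_invariance]).  By compactness ([fip_ultrafilter],
    [ultralimit_type]) the translates of p have a limit that satisfies all of
    them, and that limit lies in X, as X is closed. *)

Set Implicit Arguments.
Unset Strict Implicit.
Unset Printing Implicit Defensive.

Local Open Scope classical_set_scope.

(** * Finite sets and ultrafilters *)

Lemma finite_set_range T (A : set T) :
  finite_set A -> exists s (e : 'I_s -> T), A = range e.
Proof.
move=> /(@finite_seqP {classic T})[s ->]; exists (size s), (tnth (in_tuple s)).
apply/seteqP; split=> [x /= /(@tnthP _ _ (in_tuple s))[i ->]|_ [i _ <-]] /=.
  by exists i.
exact: (mem_tnth i (in_tuple s)).
Qed.

Lemma finite_set_tuples T k (B : set T) :
  finite_set B -> finite_set [set a : 'I_k -> T | range a `<=` B].
Proof.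
move=> /finite_set_range[s [e ->]].
apply: (@sub_finite_set _ _
  (range (fun u : {ffun 'I_k -> 'I_s} => e \o u))); last first.
  exact/finite_image/finite_finset.
move=> a /= aB.
have /choice[u uP] : forall i, exists j, e j = a i.
  by move=> i; have [j _ <-] := aB _ (imageT a i); exists j.
by exists [ffun i => u i] => //; apply/funext => i /=; rewrite ffunE uP.
Qed.

(** The form of compactness used throughout: requirements [f i] that can be met
    finitely many at a time are met simultaneously in the limit along [U]. *)
Lemma fip_ultrafilter (I T : Type) (f : I -> set T) :
  (forall A : set I, finite_set A -> exists t, forall i, A i -> f i t) ->
  exists U : set_system T, UltraFilter U /\ forall i, U (f i).
Proof.
move=> fip.
pose F : set_system T := [set S | exists2 A : set I, finite_set A &
  forall t, (forall i, A i -> f i t) -> S t].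
have FF : ProperFilter F.
  apply: Build_ProperFilter_ex => [S [A finA AS]|].
    by have [t tA] := fip A finA; exists t; apply: AS.
  split=> [|S S' [A finA AS] [A' finA' AS']|S S' SS' [A finA AS]].
  - by exists set0.
  - exists (A `|` A'); first by rewrite finite_setU.
    by move=> t tA; split; [apply: AS|apply: AS'] => i Ai; apply: tA; [left|right].
  - by exists A => // t tA; apply/SS'/AS.
have [U [UU FU]] := ultraFilterLemma FF.
exists U; split=> // i; apply: FU; exists [set i] => // t; exact.
Qed.

(** * Renaming of variables *)

Section Rename.
Variables (L : language).

Lemma trename_comp V W Z (h : V -> W) (k : W -> Z) (t : term L V) :
  trename k (trename h t) = trename (k \o h) t.
Proof. by elim: t => //= f ts IH; congr App; apply/funext. Qed.

Lemma rename_comp V W Z (h : V -> W) (k : W -> Z) (phi : formula L V) :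
  rename k (rename h phi) = rename (k \o h) phi.
Proof.
elim: phi W Z h k => {V} /= [V t u|V r ts|V psi IH|V psi IH1 chi IH2|V psi IH]
  W Z h k.
- by rewrite !trename_comp.
- by congr Rel; apply/funext => i; rewrite trename_comp.
- by rewrite IH.
- by rewrite IH1 IH2.
- by rewrite IH; congr Exists; congr rename; apply/funext => -[].
Qed.

Lemma trename_id V (t : term L V) : trename id t = t.
Proof. by elim: t => //= f ts IH; congr App; apply/funext. Qed.

Lemma rename_id V (phi : formula L V) : rename id phi = phi.
Proof.
elim: phi => {V} /= [V t u|V r ts|V psi IH|V psi IH1 chi IH2|V psi IH].
- by rewrite !trename_id.
- by congr Rel; apply/funext => i; rewrite trename_id.
- by rewrite IH.
- by rewrite IH1 IH2.
- by rewrite -[in RHS]IH; congr Exists; congr rename; apply/funext => -[].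
Qed.

Lemma term_support V (t : term L V) :
  exists S : set V, finite_set S /\ forall W (h k : V -> W),
    (forall v, S v -> h v = k v) -> trename h t = trename k t.
Proof.
elim: t => [x|f ts /choice[S SP]].
  by exists [set x]; split=> // W h k hk /=; rewrite hk.
exists (\bigcup_i S i); split=> [|W h k hk /=].
  by apply: bigcup_finite => // i _; have [] := SP i.
congr App; apply/funext => i; have [_] := SP i; apply=> v Sv.
by apply: hk; exists i.
Qed.

(** Arities are finite, so a formula has finitely many free variables: [S]
    contains them all. *)
Lemma formula_support V (phi : formula L V) :
  exists S : set V, finite_set S /\ forall W (h k : V -> W),
    (forall v, S v -> h v = k v) -> rename h phi = rename k phi.
Proof.
elim: phi => {V} [V t u|V r ts|V psi [S [finS SP]]|
  V psi [S [finS SP]] chi [S' [finS' SP']]|V psi [S [finS SP]]].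
- have [S [finS SP]] := term_support t.
  have [S' [finS' SP']] := term_support u.
  exists (S `|` S'); split=> [|W h k hk /=]; first by rewrite finite_setU.
  by congr Eq; [apply: SP|apply: SP'] => v Sv; apply: hk; [left|right].
- have /choice[S SP] := fun i => term_support (ts i).
  exists (\bigcup_i S i); split=> [|W h k hk /=].
    by apply: bigcup_finite => // i _; have [] := SP i.
  congr Rel; apply/funext => i; have [_] := SP i; apply=> v Sv.
  by apply: hk; exists i.
- by exists S; split=> // W h k hk /=; rewrite (SP _ h k).
- exists (S `|` S'); split=> [|W h k hk /=]; first by rewrite finite_setU.
  by congr And; [apply: SP|apply: SP'] => v Sv; apply: hk; [left|right].
- exists (Some @^-1` S); split=> [|W h k hk /=].
    by apply: finite_preimage => // x y _ _ [].
  by congr Exists; apply: SP => -[v Sv|//] /=; congr Some; apply: hk.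
Qed.

End Rename.

(** * Instances and automorphisms *)

Section Instances.
Variables (L : language) (M : structure L).

Lemma rename_params_instance n k (h : M -> M) (psi : formula L ('I_k + 'I_n))
    (a : 'I_k -> M) :
  rename_params h (instance psi a) = instance psi (h \o a).
Proof.
by rewrite /rename_params /instance rename_comp; congr rename; apply/funext => -[].
Qed.

Lemma rename_params_comp n (h k : M -> M) (phi : param_formula M n) :
  rename_params k (rename_params h phi) = rename_params (k \o h) phi.
Proof. by rewrite /rename_params rename_comp; congr rename; apply/funext => -[]. Qed.

(** Finitely many formulas over M involve finitely many parameters, which one
    tuple [a] can list.  The point [x0] is put in [a] as well, so that [a] is
    nonempty and the parameters outside of [a] can be sent to some entry. *)
Lemma common_parameters n s (x0 : M) (phi : 'I_s -> param_formula M n) :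
  exists k (a : 'I_k -> M) (psi : 'I_s -> formula L ('I_k + 'I_n)),
    forall j, phi j = instance (psi j) a.
Proof.
have /choice[S SP] := fun j => formula_support (phi j).
have [|k [a aE]] := @finite_set_range M
    ([set x0] `|` \bigcup_j ((inr : M -> 'I_n + M) @^-1` S j)).
  rewrite finite_setU; split=> //; apply: bigcup_finite => // j _.
  by apply: finite_preimage; [move=> x y _ _ []|have [] := SP j].
have [i0 _ _] : range a x0 by rewrite -aE; left.
have /choice[idx idxP] : forall m, exists i, range a m -> a i = m.
  by move=> m; case: (pselect (range a m)) => [[i _ <-]|?]; [exists i|exists i0].
exists k, a, (fun j => rename (fun v : 'I_n + M => match v with
  | inl y => inr y | inr m => inl (idx m) end) (phi j)) => j.
(* the composite renaming is the identity on the support of [phi j] *)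
rewrite /instance rename_comp -[LHS]rename_id.
have [_] := SP j; apply=> -[//|m Sm] /=; rewrite idxP // -aE.
by right; exists j.
Qed.

Lemma inverse_finterp (g : automorphism M) f v :
  aut_inv g (finterp M f v) = finterp M f (aut_inv g \o v).
Proof.
apply: (can_inj (aut_funK g)); rewrite aut_invK aut_finterp; congr finterp.
by apply/funext => i /=; rewrite aut_invK.
Qed.

Lemma inverse_rinterp (g : automorphism M) r v :
  rinterp M r (aut_inv g \o v) <-> rinterp M r v.
Proof.
rewrite -(aut_rinterp g).
suff -> : g \o (aut_inv g \o v) = v by [].
by apply/funext => i /=; rewrite aut_invK.
Qed.

Definition aut_inverse (g : automorphism M) : automorphism M :=
  Automorphism (aut_invK g) (aut_funK g) (inverse_finterp g) (inverse_rinterp g).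

Lemma comp_finterp (g h : automorphism M) f v :
  (g \o h) (finterp M f v) = finterp M f ((g \o h) \o v).
Proof. by rewrite /= !aut_finterp. Qed.

Lemma comp_rinterp (g h : automorphism M) r v :
  rinterp M r ((g \o h) \o v) <-> rinterp M r v.
Proof. exact: iff_trans (aut_rinterp g (h \o v)) (aut_rinterp h v). Qed.

Definition aut_comp (g h : automorphism M) : automorphism M :=
  Automorphism (can_comp (aut_funK g) (aut_funK h))
    (can_comp (aut_invK h) (aut_invK g)) (comp_finterp g h) (comp_rinterp g h).

Lemma id_finterp f v : @id M (finterp M f v) = finterp M f (id \o v).
Proof. by []. Qed.

Lemma id_rinterp r v : rinterp M r (@id M \o v) <-> rinterp M r v.
Proof. by []. Qed.

Definition aut_id : automorphism M :=
  Automorphism (fun x => erefl x) (fun x => erefl x) id_finterp id_rinterp.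

End Instances.

(** * Compactness of type spaces *)

Section Types.
Variables (L : language) (M : structure L) (n : nat).
Implicit Types (p q : complete_type M n) (phi : param_formula M n).

Lemma complete_type_ext p q :
  (forall phi, ctype_set p phi <-> ctype_set q phi) -> p = q.
Proof.
case: p q => [P P1 P2] [Q Q1 Q2] /= PQ.
have EPQ : P = Q by apply/funext => phi; apply/propext.
by case: _ / EPQ Q1 Q2 {PQ} => Q1 Q2; congr CompleteType; exact: Prop_irrelevance.
Qed.

Lemma ctype_Not p phi : ctype_set p (Not phi) <-> ~ ctype_set p phi.
Proof.
split=> [pN pphi|npphi]; last by have [] := ctype_complete p phi.
have [||b bP] := ctype_finsat (c := p) (A := [set phi; Not phi]).
- by rewrite finite_setU.
- by move=> _ [->|->].
by have := bP (Not phi); apply; [right|apply: bP; left].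
Qed.

Lemma realized_finsat (b : 'I_n -> M) (A : set (param_formula M n)) :
  finite_set A -> A `<=` [set phi | sat (param_val b) phi] ->
  exists b : 'I_n -> M, forall phi, A phi -> sat (param_val b) phi.
Proof. by move=> _ Ab; exists b. Qed.

Lemma realized_complete (b : 'I_n -> M) phi :
  sat (param_val b) phi \/ sat (param_val b) (Not phi).
Proof. exact: EM. Qed.

Definition realized_type (b : 'I_n -> M) : complete_type M n :=
  CompleteType (realized_finsat (b := b)) (realized_complete b).

(** Compactness of the type space, read off formulas: finitely many formulas of
    the limit lie in a common [p i], hence are satisfiable together, and
    completeness is the dichotomy for ultrafilters. *)
Lemma ultralimit_type (I : Type) (U : set_system I) (p : I -> complete_type M n) :
  UltraFilter U ->
  exists q, forall phi, ctype_set q phi <-> U [set i | ctype_set (p i) phi].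
Proof.
move=> UU.
have finsat (A : set (param_formula M n)) : finite_set A ->
    A `<=` [set phi | U [set i | ctype_set (p i) phi]] ->
    exists b : 'I_n -> M, forall phi, A phi -> sat (param_val b) phi.
  move=> /finite_set_range[s [e ->]] AU.
  have /filter_ex[i iP] : U [set i | forall j, ctype_set (p i) (e j)].
    by apply: filter_forall => j; apply: AU; exists j.
  have [||b bP] := ctype_finsat (c := p i) (A := range e).
  - exact/finite_image/finite_finset.
  - by move=> _ [j _ <-].
  by exists b.
have complete phi : U [set i | ctype_set (p i) phi] \/
    U [set i | ctype_set (p i) (Not phi)].
  case: (in_ultra_setVsetC [set i | ctype_set (p i) phi] UU) => [|UN].
    by left.
  by right; apply: filterS UN => i /= /ctype_Not.
by exists (CompleteType finsat complete).
Qed.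

(** The sets of types that contain a given finite part of [p] form a
    neighborhood basis at [p], so topological arguments reduce to finite sets
    of formulas. *)
Lemma closure_typeP (X : set (complete_type M n)) p :
  closure X p <-> forall A : set (param_formula M n), finite_set A ->
    A `<=` p -> exists2 q, X q & A `<=` q.
Proof.
split=> [Xp A /finite_set_range[s [e ->]] Ap|XP B].
  have [|q [Xq qP]] := Xp [set q | forall j, type_basic_open (e j) q].
    apply: (@filter_forall _ _ (fun j => type_basic_open (e j)) (nbhs p)) => j.
    apply: open_nbhs_nbhs; split; last by apply: Ap; exists j.
    exists [set type_basic_open (e j)]; last by rewrite bigcup_set1.
    by move=> _ ->; apply: finI_from1; exists (e j).
  by exists q => // _ [j _ <-]; apply: qP.
rewrite nbhsE => -[O [[D' D'b <-] [O' D'O' O'p]] OB].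
have [D Db DE] := D'b _ D'O'.
(* [O'] is the intersection of the basic open sets in the finite set [D] *)
have /finite_set_range[s [e eD]] := finite_fset D.
have /choice[w wP] : forall j, exists phi, type_basic_open phi = e j.
  move=> j; have : range e (e j) by exists j.
  by rewrite -eD => /Db; rewrite inE => -[phi _ <-]; exists phi.
have [||q Xq qP] := XP (range w).
- exact/finite_image/finite_finset.
- move=> _ [j _ <-]; have : type_basic_open (w j) p; last by [].
  (* [O'] has the index type of the basis; the cast shows it as a set of types *)
  have O'p' : (O' : set (complete_type M n)) p := O'p.
  by rewrite wP; move: O'p'; rewrite -DE; apply; rewrite eD; exists j.
exists q; split=> //; apply: OB; exists O' => //.
suff : (O' : set (complete_type M n)) q by [].
rewrite -DE => P; rewrite eD => -[j _ <-].
have : type_basic_open (w j) q by apply: qP; exists j.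
by rewrite wP.
Qed.

End Types.

Lemma act_instance L (M : structure L) k n (g : automorphism M)
    (p : complete_type M n) (psi : formula L ('I_k + 'I_n)) (a : 'I_k -> M) :
  ctype_set (act g p) (instance psi a) <->
  ctype_set p (instance psi (aut_inv g \o a)).
Proof. by rewrite -rename_params_instance. Qed.

(** * From fixed points to the Ramsey property *)

(** Types [p i] in [m] variables each have a common extension in the disjoint
    union of these variables, because finite parts of the given types
    are realized independently of each other.  One more variable, with the
    arbitrary value [x0], makes the number of variables positive. *)
Lemma joint_type L (M : structure L) n m (x0 : M) (p : 'I_n -> complete_type M m) :
  exists N (sigma : 'I_n -> 'I_m -> 'I_N) (q : complete_type M N), (0 < N)%N /\
    forall i phi, ctype_set q (rename (fun v => match v with
      | inl j => inl (sigma i j) | inr x => inr x end) phi) <-> ctype_set (p i) phi.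
Proof.
pose J := option ('I_n * 'I_m).
pose join (b : 'I_n -> 'I_m -> M) (v : 'I_#|{: J}|) : M :=
  match enum_val v with Some ij => b ij.1 ij.2 | None => x0 end.
have [|U [UU Up]] := @fip_ultrafilter ('I_n * param_formula M m)
    ('I_n -> 'I_m -> M) (fun iphi => [set b | ctype_set (p iphi.1) iphi.2 ->
      sat (param_val (b iphi.1)) iphi.2]).
  move=> A finA.
  have /choice[b bP] : forall i, exists bi : 'I_m -> M, forall phi,
      A (i, phi) -> ctype_set (p i) phi -> sat (param_val bi) phi.
    move=> i; have [||bi biP] := ctype_finsat (c := p i)
      (A := [set phi | A (i, phi) /\ ctype_set (p i) phi]).
    - apply: (@sub_finite_set _ _ (snd @` A)); last exact: finite_image.
      by move=> phi [Aphi _]; exists (i, phi).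
    - by move=> phi [].
    by exists bi => phi Aphi pphi; apply: biP.
  by exists b => -[i phi] /=; apply: bP.
have [q qP] := ultralimit_type (fun b => realized_type (join b)) UU.
exists #|{: J}|, (fun i j => enum_rank (Some (i, j) : J)), q; split.
  by rewrite card_option.
move=> i phi; rewrite qP /=.
set h := (X in rename X).
have joinE b :
    sat (param_val (join b)) (rename h phi) <-> sat (param_val (b i)) phi.
  rewrite sat_rename; suff -> : param_val (join b) \o h = param_val (b i) by [].
  by apply/funext => -[j|x] //=; rewrite /join enum_rankK.
have -> : [set b | sat (param_val (join b)) (rename h phi)] =
    [set b | sat (param_val (b i)) phi].
  by apply/seteqP; split=> b /=; rewrite joinE.
split=> [Uphi|pphi]; last by apply: filterS (Up (i, phi)) => b; apply.
case: (ctype_complete (p i) phi) => // pN.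
by have [b [/(_ pN)]] := filter_ex (filterI (Up (i, Not phi)) Uphi).
Qed.

Section FPTRamsey.
Variables (L : language) (M : structure L).

Definition orbit_closure n (q : complete_type M n) : set (complete_type M n) :=
  closure (range (fun g : automorphism M => act g q)).

Lemma orbit_closure_subflow n (q : complete_type M n) : subflow (orbit_closure q).
Proof.
split=> [||g p /closure_typeP pP].
- by exists (act (aut_id M) q); apply: subset_closure; exists (aut_id M).
- exact: closed_closure.
apply/closure_typeP => A finA Ap.
have [||_ [h _ <-] hP] := pP (rename_params (aut_inv g) @` A).
- exact: finite_image.
- by move=> _ [phi /Ap ? <-].
exists (act (aut_comp g h) q); first by exists (aut_comp g h).
move=> phi Aphi; have /hP : (rename_params (aut_inv g) @` A)
  (rename_params (aut_inv g) phi) by exists phi.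
by rewrite /= /act_set /= rename_params_comp.
Qed.

Lemma FPT_Ramsey : FPT M -> externally_definable_Ramsey M.
Proof.
move=> fpt k a B finB aB n c [m [phi [p cP]]].
have [x0|M0] := pselect (inhabited M); last first.
  (* [M] is empty: there is only one [k]-tuple *)
  have tE (a' a'' : 'I_k -> M) : a' = a''.
    by apply/funext => i; case: M0; exists; exact: a' i.
  exists B.
    by exists (aut_id M); rewrite image_id.
  rewrite (_ : _ @` _ = [set c a]) ?card_set1 //; apply/seteqP; split.
    by move=> _ [a' _ <-] /=; rewrite (tE a' a).
  by move=> _ ->; exists a => //; split=> //; exists (aut_id M).
case: x0 => x0.
have [N [sigma [q [N_gt0 qP]]]] := joint_type x0 p.
pose psi i : formula L ('I_k + 'I_N) := rename (fun v => match v with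
  | inl x => inl x | inr j => inr (sigma i j) end) (phi i).
have cq a' i : tuple_copies setT a a' ->
    c a' i = `[< ctype_set q (instance (psi i) a') >].
  move=> /(cP _ i)[c1 c0].
  have -> : ctype_set q (instance (psi i) a') =
      ctype_set (p i) (instance (phi i) a').
    apply/propext; rewrite -qP /instance !rename_comp.
    set h := (X in rename X); set h' := (X in _ <-> ctype_set q (rename X _)).
    by have -> : h = h' by apply/funext => -[].
  apply/idP/asboolP => [ci|/c1->//].
  by case: (ctype_complete (p i) (instance (phi i) a')) => // /c0; rewrite ci.
have [r /closure_typeP rq rfix] := fpt N N_gt0 _ (orbit_closure_subflow q).
pose T : set ('I_k -> M) := [set a' | range a' `<=` B].
have finT : finite_set T by exact: finite_set_tuples.
(* the part of [r] inside [Phi] decides all [instance (psi i) a'], [a'] in [B] *)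
pose Phi := \bigcup_(i : 'I_n) ((fun a' => instance (psi i) a') @` T `|`
  (fun a' => Not (instance (psi i) a')) @` T).
have [||_ [h _ <-] hP] := rq (Phi `&` r).
- apply: finite_setIl; apply: bigcup_finite => [|i _].
    exact: finite_finset.
  by rewrite finite_setU; split; apply: finite_image.
- by move=> ? [].
have rh i a' : T a' ->
    ctype_set q (instance (psi i) (aut_inv h \o a')) <->
    ctype_set r (instance (psi i) a').
  move=> Ta'; rewrite -act_instance; split=> [hq|ra'].
    case: (ctype_complete r (instance (psi i) a')) => // /[dup] rN.
    suff /hP/ctype_Not : (Phi `&` r) (Not (instance (psi i) a')) by [].
    by split=> //; exists i => //; right; exists a'.
  by apply: hP; split=> //; exists i => //; left; exists a'.
have rconst i (g : automorphism M) :
    ctype_set r (instance (psi i) (g \o a)) = ctype_set r (instance (psi i) a).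
  by rewrite -[in RHS](rfix (aut_inverse g)) -rename_params_instance.
exists (aut_inv h @` B); first by exists (aut_inverse h).
have cE a' : tuple_copies (aut_inv h @` B) a a' ->
    c a' = [ffun i => `[< ctype_set r (instance (psi i) a) >]].
  move=> [a'B [g ga']]; apply/ffunP => i.
  rewrite ffunE cq; last by split=> //; exists g.
  have ha' : a' = aut_inv h \o (h \o a') by apply/funext => j /=; rewrite aut_funK.
  rewrite {1}ha'; apply/asbool_equiv_eq; rewrite rh; last first.
    move=> _ [j _ <-] /=; have [x Bx <-] := a'B _ (imageT a' j).
    by rewrite aut_invK.
  by rewrite ga' (rconst i (aut_comp h g)).
rewrite (_ : _ @` _ = [set [ffun i => `[< ctype_set r (instance (psi i) a) >]]]).
  exact: card_set1.
apply/seteqP; split=> [_ [a' /cE -> <-]//|_ ->].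
have ha : tuple_copies (aut_inv h @` B) a (aut_inv h \o a).
  split; last by exists (aut_inverse h).
  by move=> _ [j _ <-]; exists (a j) => //; apply: aB; exists j.
by exists (aut_inv h \o a) => //; exact: cE.
Qed.

End FPTRamsey.

(** * From the Ramsey property to fixed points *)

Section RamseyFPT.
Variables (L : language) (M : structure L).

(** Some translate of [p] satisfies any finite part of the requirements for a
    fixed point.  The set [B] of the proof consists of the entries of the tuples
    that these requirements compare. *)
Lemma Ramsey_finite_invariance n (x0 : M) (p : complete_type M n)
    (A : set (automorphism M * param_formula M n)) :
  externally_definable_Ramsey M -> finite_set A ->
  exists h : automorphism M, forall g phi, A (g, phi) ->
    (ctype_set (act h p) phi <-> ctype_set (act h p) (rename_params g phi)).
Proof.
move=> ramsey /finite_set_range[s [e AE]].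
have [k [a [psi psiP]]] := common_parameters x0 (fun j => (e j).2).
pose B := range a `|` \bigcup_j range ((e j).1 \o a).
pose c (a' : 'I_k -> M) : {ffun 'I_s -> bool} :=
  [ffun j => `[< ctype_set p (instance (psi j) a') >]].
have [|||B' [h ->] cB] := ramsey k a B _ _ s c.
- rewrite finite_setU; split; first exact/finite_image/finite_finset.
  by apply: bigcup_finite => // j _; exact/finite_image/finite_finset.
- by move=> x ax; left.
- exists n, psi, (fun=> p) => a' j _; rewrite ffunE; split=> [|/ctype_Not] pa'.
    exact/asboolP.
  exact/asboolPn.
have /eq_cardSP[x _] := cB; rewrite II0 card_eq0 => /eqP cBx.
have cconst (g : automorphism M) : range (g \o a) `<=` B -> c (h \o (g \o a)) = x.
  move=> gB; apply: contrapT => cneq.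
  suff : set0 (c (h \o (g \o a))) by [].
  rewrite -cBx; split=> //; exists (h \o (g \o a)) => //; split.
    by move=> _ [i _ <-]; exists (g (a i)) => //; apply: gB; exists i.
  by exists (aut_comp h g).
exists (aut_inverse h) => g phi; rewrite AE => -[j _ ej].
have c1 : c (h \o a) = x by apply: (cconst (aut_id M)) => y ay; left.
have cg : c (h \o (g \o a)) = x.
  apply: cconst => _ [i _ <-].
  by right; exists j => //; exists i => //=; rewrite ej.
have -> : phi = instance (psi j) a by rewrite -psiP ej.
rewrite rename_params_instance !act_instance.
have /ffunP/(_ j) := etrans c1 (esym cg); rewrite !ffunE => pE.
by split=> /asboolP; [rewrite pE|rewrite -pE] => /asboolP.
Qed.

Lemma Ramsey_FPT : externally_definable_Ramsey M -> FPT M.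
Proof.
move=> ramsey n n_gt0 X [[p Xp] closedX invX].
have [||b _] := ctype_finsat (c := p) (A := set0) => //.
pose x0 := b (Ordinal n_gt0).
have [|U [UU Up]] := @fip_ultrafilter (automorphism M * param_formula M n)
    (automorphism M) (fun gphi => [set h | ctype_set (act h p) gphi.2 <->
      ctype_set (act h p) (rename_params gphi.1 gphi.2)]).
  move=> A /(Ramsey_finite_invariance x0 p ramsey)[h hP].
  by exists h => -[g phi] /hP.
have [q qP] := ultralimit_type (fun h => act h p) UU.
exists q.
  have -> : X = closure X by exact/closure_id.
  apply/closure_typeP => A /finite_set_range[s [e ->]] Aq.
  have /filter_ex[h hP] : U [set h | forall j, ctype_set (act h p) (e j)].
    by apply: filter_forall => j; apply/qP/Aq; exists j.
  by exists (act h p); [apply: invX|move=> _ [j _ <-]; apply: hP].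
move=> g; apply: complete_type_ext => phi.
suff : ctype_set q (rename_params (aut_inverse g) phi) <-> ctype_set q phi by [].
rewrite !qP; split=> Uphi; apply: filterS (filterI Uphi (Up (aut_inverse g, phi)));
  by move=> h [hphi /= hP]; apply/hP.
Qed.

End RamseyFPT.

Theorem theorem4p10 (L : language) (M : structure L) (hM : ultrahomogeneous M) :
  externally_definable_Ramsey M <-> FPT M.
Proof. by split; [exact: Ramsey_FPT|exact: FPT_Ramsey]. Qed.
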